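(* Let $\{\mathbf{x}^k\}_{k\ge 0}$ and $\{\mathbf{y}^k\}_{k\ge 0}$ be the two sequences generated by the Bi-SG Algorithm (Version I or Version II) with parameter $\alpha\in(1/2,1)$. Let $\mathbf{x}'\in X'$, and let $D$ and $H$ be the associated constants defined in the context. Then for every integer $k\ge 1$, $$\varphi(\mathbf{y}^{k_{best}})-\varphi(\mathbf{x}')\le \frac{2H}{k^{\alpha}}\qquad\text{and}\qquad \omega(\mathbf{y}^{k_{best}})-\omega(\mathbf{x}')\le \frac{2D^2}{c\,k^{1-\alpha}},$$ where $k_{best}\in\arg\min\{\omega(\mathbf{y}^j): k\le j\le 2k\}$.
   Context: Problem. The inner problem is $\min_{\mathbf{x}\in\mathbb{R}^n}\{\varphi(\mathbf{x}):=f(\mathbf{x})+g(\mathbf{x})\}$, where $f:\mathbb{R}^n\to\mathbb{R}$ is convex and continuously differentiable with $L_f$-Lipschitz gradient ($L_f>0$), $g:\mathbb{R}^n\to(-\infty,\infty]$ is proper, lower semicontinuous and convex, and the set $X^*$ of minimizers of $\varphi$ is nonempty. The outer problem is $\min_{\mathbf{x}\in X^*}\omega(\mathbf{x})$, where $\omega:\mathbb{R}^n\to\mathbb{R}$ is convex and coercive ($\omega(\mathbf{x})\to\infty$ as $\|\mathbf{x}\|\to\infty$). $X'$ denotes the set of optimal solutions of the outer problem. The norm $\|\cdot\|$ is the Euclidean norm. Notation. For a smooth convex $s$, a proper lower semicontinuous convex $h$ and $t>0$: $\mathrm{prox}_{th}(\mathbf{x})=\arg\min_{\mathbf{u}}\{t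 h(\mathbf{u})+\frac12\|\mathbf{u}-\mathbf{x}\|^2\}$, $T_t^{s,h}(\mathbf{x})=\mathrm{prox}_{th}(\mathbf{x}-t\nabla s(\mathbf{x}))$, and the gradient mapping is $G_t^{s,h}(\mathbf{x})=\frac1t(\mathbf{x}-T_t^{s,h}(\mathbf{x}))$. A mapping $F:\mathbb{R}^n\to\mathbb{R}^n$ is quasi Lipschitz with constants $(d_1,d_2)$, $d_1,d_2\ge0$, if $\|F(\mathbf{x})\|\le\max\{d_1,d_2\|\mathbf{x}\|\}$ for all $\mathbf{x}$. Bi-SG Algorithm. Input $\alpha$, $c>0$, and $\eta_k=c(k+1)^{-\alpha}$. Start from any $\mathbf{x}^0\in\mathbb{R}^n$. For $k=0,1,2,\dots$: $\mathbf{y}^k=T_{t_k}^{f,g}(\mathbf{x}^k)$ with $t_k=1/L_k$, then $\mathbf{x}^{k+1}=\mathbf{y}^k-\eta_k\Omega_k(\mathbf{y}^k)$, where: - Version I: $c\le1$; $\Omega_k=\Omega$ for all $k$, where $\Omega:\mathbb{R}^n\to\mathbb{R}^n$ satisfies $\Omega(\mathbf{x})\in\partial\omega(\mathbf{x})$ for all $\mathbf{x}$ and $\Omega$ is quasi Lipschitz (such a selection is assumed to exist). - Version II: it is assumed that $\omega=\sigma+\psi$ with $\sigma:\mathbb{R}^n\to\mathbb{R}$ convex, continuously differentiable with $L_\sigma$-Lipschitz gradient ($L_\sigma>0$) and $\psi:\mathbb{R}^n\to\mathbb{R}$ proper, lower semicontinuous and convex; $c\le\min\{1/L_\sigma,1\}$;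 $\Omega_k=G_{\eta_k}^{\sigma,\psi}$, i.e. $\mathbf{x}^{k+1}=\mathrm{prox}_{\eta_k\psi}(\mathbf{y}^k-\eta_k\nabla\sigma(\mathbf{y}^k))$. Step-sizes. Either constant, $L_k=L_f$ for all $k$, in which case $\bar L:=L_f$; or backtracking with parameters $\gamma>0$, $\rho>1$: $L_{-1}=\gamma$ and $L_k=L_{k-1}\rho^{i_k}$, where $i_k$ is the smallest non-negative integer such that, with $t_k=1/L_k$, $f(T_{t_k}^{f,g}(\mathbf{x}^k))\le f(\mathbf{x}^k)+\langle\nabla f(\mathbf{x}^k),T_{t_k}^{f,g}(\mathbf{x}^k)-\mathbf{x}^k\rangle+\frac{L_k}{2}\|T_{t_k}^{f,g}(\mathbf{x}^k)-\mathbf{x}^k\|^2$; in this case $\bar L:=\max\{L_f\rho,\gamma\}$. Constants. For the given $\mathbf{x}'\in X'$, $D_1,D_2>0$ are constants with $\|\mathbf{x}^k-\mathbf{x}'\|\le D_1$ and $\|\Omega_k(\mathbf{y}^k)\|\le D_2$ for all $k\ge0$ (such constants exist) and, in Version II, also $\|\xi\|\le D_2$ for every $\xi\in\partial\omega(\mathbf{y}^k)$ and every $k\ge0$. Set $D=D_1+D_2$ and, for $\alpha\in(1/2,1)$, $H=D^2\bar L/(1-\alpha)$. *)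

(* Defs.v *)
(* MathComp-Analysis. The space R^n is 'rV[R]_n, with R : realType. *)
From mathcomp Require Import all_boot all_order all_algebra.
From mathcomp Require Import all_classical all_reals all_analysis.
Import Order.TTheory GRing.Theory Num.Theory.
Import numFieldNormedType.Exports.

Set Implicit Arguments.
Unset Strict Implicit.
Unset Printing Implicit Defensive.

Local Open Scope classical_set_scope.
Local Open Scope ring_scope.

Section Space.
Context {R : realType} {n : nat}.
Implicit Types (u v x z : 'rV[R]_n) (s f : 'rV[R]_n -> R).

Definition dot u v : R := \sum_(i < n) u 0 i * v 0 i.

(* The canonical norm `|x| of 'rV[R]_n is the sup norm; it induces the same
   topology and the same notion of differentiability, but the quantitative
   statements need the Euclidean norm. *)
Definition enorm x : R := Num.sqrt (dot x x).

Definition gradient s x : 'rV[R]_n := \row_(i < n) 'D_(delta_mx 0 i) s x.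

Definition smooth_convex s (L : R) : Prop :=
  [/\ convex_function [set: 'rV[R]_n] s,
      forall x, differentiable s x,
      continuous (gradient s) &
      forall x z, enorm (gradient s x - gradient s z) <= L * enorm (x - z)].

Definition subdiff s x : set 'rV[R]_n :=
  [set xi | forall z, s x + dot xi (z - x) <= s z].

Definition coercive s : Prop :=
  forall M : R, exists r : R, forall x, r <= enorm x -> M <= s x.

Definition quasi_lipschitz (F : 'rV[R]_n -> 'rV[R]_n) (d1 d2 : R) : Prop :=
  forall x, enorm (F x) <= Num.max d1 (d2 * enorm x).

End Space.

Section Extended.
Context {R : realType}.
Local Open Scope ereal_scope.

Definition argmin (T : Type) (A : set T) (F : T -> \bar R) : set T :=
  [set u | A u /\ forall v, A v -> F u <= F v].

Context {n : nat}.
Implicit Types (h g : 'rV[R]_n -> \bar R).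

Definition proper_fun h : Prop :=
  (forall x, h x != -oo) /\ (exists x, h x != +oo).

(* Uses the library convention 0 * +oo = 0, under which the cases t = 0 and
   t = 1 are trivial. *)
Definition convex_efun h : Prop :=
  forall (x z : 'rV[R]_n) (t : R), (0 <= t <= 1)%R ->
    h (t *: x + (1 - t) *: z)%R <= t%:E * h x + (1 - t)%:E * h z.

Definition proper_lsc_convex h : Prop :=
  [/\ proper_fun h, lower_semicontinuous h & convex_efun h].

(* The minimizer is unique when h is proper, lower semicontinuous and convex
   and t > 0; otherwise [get] picks an arbitrary minimizer, if there is one. *)
Definition prox (t : R) h (x : 'rV[R]_n) : 'rV[R]_n :=
  get (argmin [set: 'rV[R]_n]
         (fun u => t%:E * h u + (2^-1 * enorm (u - x) ^+ 2)%:E)).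

Definition prox_grad (t : R) (s : 'rV[R]_n -> R) h (x : 'rV[R]_n) : 'rV[R]_n :=
  prox t h (x - t *: gradient s x).

Definition grad_map (t : R) (s : 'rV[R]_n -> R) h (x : 'rV[R]_n) : 'rV[R]_n :=
  (t^-1 *: (x - prox_grad t s h x))%R.

Definition inner_obj (f : 'rV[R]_n -> R) g : 'rV[R]_n -> \bar R :=
  fun x => (f x)%:E + g x.

Definition inner_sols (f : 'rV[R]_n -> R) g : set 'rV[R]_n :=
  argmin [set: 'rV[R]_n] (inner_obj f g).

Definition outer_sols (f : 'rV[R]_n -> R) g (omega : 'rV[R]_n -> R)
    : set 'rV[R]_n :=
  argmin (inner_sols f g) (EFin \o omega).

End Extended.

Section BiSG.
Context {R : realType} {n : nat}.
Variables (f : 'rV[R]_n -> R) (g : 'rV[R]_n -> \bar R).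

Definition backtrack_test (l : R) (x : 'rV[R]_n) : Prop :=
  let T := prox_grad l^-1 f g x in
  f T <= f x + dot (gradient f x) (T - x) + l / 2 * enorm (T - x) ^+ 2.

(* L_(k-1), where L_(-1) = gamma *)
Definition Lprev (gamma : R) (L : nat -> R) (k : nat) : R :=
  if k is k'.+1 then L k' else gamma.

Definition backtracking (gamma rho : R) (x : nat -> 'rV[R]_n) (L : nat -> R)
    : Prop :=
  exists i : nat -> nat, forall k,
    [/\ L k = Lprev gamma L k * rho ^+ i k,
        backtrack_test (L k) (x k) &
        forall m, (m < i k)%N ->
          ~ backtrack_test (Lprev gamma L k * rho ^+ m) (x k)].

Inductive step_rule (Lf : R) (x : nat -> 'rV[R]_n) (L : nat -> R) (Lbar : R)
    : Prop :=
| ConstantStep of (forall k, L k = Lf) & Lbar = Lf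
| BacktrackingStep (gamma rho : R) of
    0 < gamma & 1 < rho & backtracking gamma rho x L
    & Lbar = Num.max (Lf * rho) gamma.

Definition bisg_eta (c alpha : R) (k : nat) : R := c * k.+1%:R `^ (- alpha).

Definition bisg_iterates (eta : nat -> R)
    (Omega : nat -> 'rV[R]_n -> 'rV[R]_n) (L : nat -> R)
    (x y : nat -> 'rV[R]_n) : Prop :=
  forall k, y k = prox_grad (L k)^-1 f g (x k) /\
            x k.+1 = y k - eta k *: Omega k (y k).

End BiSG.

Section Versions.
Context {R : realType} {n : nat}.
Variables (omega : 'rV[R]_n -> R) (c : R).
Implicit Type Omega : nat -> 'rV[R]_n -> 'rV[R]_n.

Definition versionI Omega : Prop :=
  c <= 1 /\
  exists Om : 'rV[R]_n -> 'rV[R]_n,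
    [/\ forall z, subdiff omega z (Om z),
        exists d1 d2 : R, [/\ 0 <= d1, 0 <= d2 & quasi_lipschitz Om d1 d2] &
        forall k, Omega k = Om].

Definition versionII (eta : nat -> R) Omega : Prop :=
  exists (sigma psi : 'rV[R]_n -> R) (Lsigma : R),
    [/\ forall z, omega z = sigma z + psi z,
        0 < Lsigma /\ smooth_convex sigma Lsigma,
        proper_lsc_convex (EFin \o psi),
        c <= Num.min Lsigma^-1 1 &
        forall k, Omega k = grad_map (eta k) sigma (EFin \o psi)].

End Versions.

(* Main.v *)
Require Import Defs.
From mathcomp Require Import all_boot all_order all_algebra.
From mathcomp Require Import all_classical all_reals all_analysis.
From mathcomp Require Import ring lra.
Import Order.TTheory GRing.Theory Num.Theory.
Import numFieldNormedType.Exports.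

(** Write F = f + g, F* for its minimum, e_k = F(y_k) - F*, and
    s_k = |x_k - y_k|.

    The engine of both estimates is the decrease inequality of a proximal
    gradient step y from x with step 1/l ([prox_grad_decrease]): for every z,
      F(y) - F(z) <= l/2 (|z - x|^2 - |z - y|^2)
                  <= l (s |z - x| - s^2/2)   with s = |x - y|.
    It combines three facts: f lies above its tangents, f lies below its
    tangents plus (l/2)|.|^2 at the step taken, and the proximal point satisfies
    the first-order optimality condition. The proximal point exists because g
    has an affine minorant: at a minimizer u of F, the vector -grad f(u) is a
    subgradient of g.

    Inner rate ([inner_rate]). Averaging the decrease inequalities with z = x' over
    all indices up to k only yields
    e_k = O(k^(1 - 2 alpha)), because e_k need not decrease and the increments
    eta_j^2 accumulate. Instead the inequality is used twice at each step, with
    z = x' and with z = y_(k-1), which is within eta_(k-1) D2 of x_k: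
      e_k <= L_k (s_k D1 - s_k^2/2),
      e_k <= e_(k-1) + L_k (s_k eta_(k-1) D2 - s_k^2/2).
    If e_k is large compared with eta_(k-1), the first bound makes s_k large, and
    then the second one forces a decrease of order e_k eta_(k-1). Since
    k^(-alpha) - (k+1)^(-alpha) <= 2 (k+1)^(-2 alpha), this decrease is enough to
    propagate e_k <= 4 Lbar D^2 k^(-alpha) by induction ([rate_step]). The bound
    holds for every index, so also for k_best >= k, and 4 <= 2/(1 - alpha).

    Outer rate. Each iteration satisfies ([bisg_outer_step])
      2 eta_j (omega(y_j) - omega(x'))
        <= |x_j - x'|^2 - |x_(j+1) - x'|^2 + 2 eta_j^2 D2^2.
    In the first version this is the subgradient step estimate. In the second one
    the decrease inequality for omega = sigma + psi bounds omega(x_(j+1)), and a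
    subgradient of omega at y_j, which exists by a finite-dimensional
    Hahn-Banach argument ([subdiff_nonempty]), pays for replacing x_(j+1) by y_j.
    Summing over k <= j <= 2k, where the eta_j^2 add up to at most 1 and the eta_j
    to at least c k^(1 - alpha)/2, gives the bound on the smallest
    omega(y_j). *)

Set Implicit Arguments.
Unset Strict Implicit.
Unset Printing Implicit Defensive.

Local Open Scope classical_set_scope.
Local Open Scope ring_scope.

(** * Euclidean norm *)

Section Euclid.
Context {R : realType} {n : nat}.
Implicit Types u v w : 'rV[R]_n.

Lemma dotC u v : dot u v = dot v u.
Proof. by apply: eq_bigr => i _; rewrite mulrC. Qed.

Lemma dotDl u v w : dot (u + v) w = dot u w + dot v w.
Proof. by rewrite -big_split; apply: eq_bigr => i _; rewrite mxE mulrDl. Qed.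

Lemma dotZl a u w : dot (a *: u) w = a * dot u w.
Proof. by rewrite mulr_sumr; apply: eq_bigr => i _; rewrite mxE mulrA. Qed.

Lemma dotNl u w : dot (- u) w = - dot u w.
Proof. by rewrite -scaleN1r dotZl mulN1r. Qed.

Lemma dotDr u v w : dot w (u + v) = dot w u + dot w v.
Proof. by rewrite !(dotC w) dotDl. Qed.

Lemma dotZr a u w : dot w (a *: u) = a * dot w u.
Proof. by rewrite !(dotC w) dotZl. Qed.

Lemma dotNr u w : dot w (- u) = - dot w u.
Proof. by rewrite !(dotC w) dotNl. Qed.

Lemma dot0r w : dot w 0 = 0.
Proof. by rewrite -(scale0r (0 : 'rV[R]_n)) dotZr mul0r. Qed.

Definition dotE := (dotDl, dotDr, dotZl, dotZr, dotNl, dotNr).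

Lemma dot_delta u (i : 'I_n) : dot u (delta_mx 0 i) = u 0 i.
Proof.
rewrite /dot (bigD1 i)//= big1 ?addr0 ?mxE ?eqxx ?mulr1// => j ji.
by rewrite mxE (negbTE ji) andbF mulr0.
Qed.

Lemma dot_ge0 u : 0 <= dot u u.
Proof. by apply: sumr_ge0 => i _; rewrite -expr2 sqr_ge0. Qed.

Lemma enorm_ge0 u : 0 <= enorm u.
Proof. exact: sqrtr_ge0. Qed.

Lemma enorm_sqr u : enorm u ^+ 2 = dot u u.
Proof. by rewrite sqr_sqrtr ?dot_ge0. Qed.

Lemma enormN u : enorm (- u) = enorm u.
Proof. by rewrite /enorm !dotE opprK. Qed.

Lemma enormZ a u : enorm (a *: u) = `|a| * enorm u.
Proof. by rewrite /enorm !dotE mulrA -expr2 sqrtrM ?sqr_ge0// sqrtr_sqr. Qed.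

Lemma enorm_eq0_dot u v : enorm u = 0 -> dot u v = 0.
Proof.
move=> u0; have /eqP : dot u u = 0 by rewrite -enorm_sqr u0 expr0n.
rewrite psumr_eq0; last by move=> i _; rewrite -expr2 sqr_ge0.
move=> /allP uu; rewrite /dot big1// => i _.
have := uu i (mem_index_enum _); rewrite /= mulf_eq0 orbb => /eqP ->.
by rewrite mul0r.
Qed.

Lemma cauchy_schwarz u v : dot u v <= enorm u * enorm v.
Proof.
have [u0|u0] := eqVneq (enorm u) 0.
  by rewrite u0 mul0r enorm_eq0_dot.
have [v0|v0] := eqVneq (enorm v) 0.
  by rewrite v0 mulr0 dotC enorm_eq0_dot.
have pu : 0 < enorm u by rewrite lt_neqAle eq_sym u0 enorm_ge0.
have pv : 0 < enorm v by rewrite lt_neqAle eq_sym v0 enorm_ge0.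
have := dot_ge0 (enorm v *: u - enorm u *: v).
rewrite !dotE (dotC v u) -!enorm_sqr.
move: (enorm u) (enorm v) (dot u v) pu pv => a b d pu pv h.
rewrite -subr_ge0 -(pmulr_rge0 _ (mulr_gt0 pu pv)).
by rewrite -(pmulr_rge0 _ (ltr0Sn R 1)); apply: le_trans h _; lra.
Qed.

Lemma enormD u v : enorm (u + v) <= enorm u + enorm v.
Proof.
rewrite -(@ler_pXn2r _ 2) ?nnegrE ?addr_ge0 ?enorm_ge0//.
rewrite sqrrD !enorm_sqr !dotE (dotC v u).
have := cauchy_schwarz u v; lra.
Qed.

Lemma norm_le_enorm u : `|u| <= enorm u.
Proof.
rewrite /Num.norm /= mx_normrE; apply/bigmax_leP; split; first exact: enorm_ge0.
move=> [i j] _ /=; rewrite ord1 /enorm -sqrtr_sqr ler_sqrt ?dot_ge0//.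
rewrite /dot (bigD1 j)//= expr2 lerDl.
by apply: sumr_ge0 => k _; rewrite -expr2 sqr_ge0.
Qed.

End Euclid.

(** * Existence of subgradients *)

Section Subgradient.
Context {R : realType} {n : nat}.
Implicit Types (s F : 'rV[R]_n -> R) (u v w x z : 'rV[R]_n).

Lemma convex_segment s x z (t : R) : convex_function [set: 'rV[R]_n] s ->
  0 <= t <= 1 -> s (t *: x + (1 - t) *: z) <= t * s x + (1 - t) * s z.
Proof.
move=> cs /andP[t0 t1].
by have := cs (Itv01 t0 t1) x z (in_setT _) (in_setT _).
Qed.

(** The one-dimensional extension step of Hahn-Banach. A slope a along e works iff
    it lies above every lower difference quotient
    (xi.v - F(v - s e))/s and below every upper one (F(v + s e) - xi.v)/s with
    s > 0. Convexity of F on the segment from v' - s' e to v + s e, whose point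
    of W is a convex combination of v' and v, separates the two families. *)
Lemma extend_minorant F (xi e : 'rV[R]_n) (W : set 'rV[R]_n) :
  (forall x z (t : R), 0 <= t <= 1 ->
    F (t *: x + (1 - t) *: z) <= t * F x + (1 - t) * F z) ->
  W 0 -> (forall x z (a b : R), W x -> W z -> W (a *: x + b *: z)) ->
  (forall v, W v -> dot xi v <= F v) ->
  exists a : R, forall v (s : R), W v -> dot xi v + a * s <= F (v + s *: e).
Proof.
move=> cF W0 WL Wxi.
have sep v v' (s s' : R) : W v -> W v' -> 0 < s -> 0 < s' ->
    (dot xi v' - F (v' - s' *: e)) / s' <= (F (v + s *: e) - dot xi v) / s.
  move=> Wv Wv' s0 s'0.
  have ss : 0 < s + s' by rewrite addr_gt0.
  have t01 : 0 <= s / (s + s') <= 1.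
    by apply/andP; split; [rewrite divr_ge0 ?ltW|rewrite ler_pdivrMr// mul1r lerDl ltW].
  have t1E : 1 - s / (s + s') = s' / (s + s') by field; rewrite gt_eqF.
  have := cF (v' - s' *: e) (v + s *: e) _ t01.
  rewrite t1E.
  have -> : (s / (s + s')) *: (v' - s' *: e) + (s' / (s + s')) *: (v + s *: e) =
            (s / (s + s')) *: v' + (s' / (s + s')) *: v.
    by apply/rowP => i; rewrite !mxE; ring.
  move=> /(le_trans (Wxi _ (WL _ _ _ _ Wv' Wv))); rewrite !dotE => h.
  rewrite ler_pdivrMr// mulrAC ler_pdivlMr//.
  move: h; rewrite -(ler_pM2l ss) !mulrDr.
  rewrite ![(s + s') * (_ / _ * _)]mulrA ![(s + s') * (_ / _)]mulrA.
  by rewrite ![(s + s') * _ / _]mulrAC !divff ?gt_eqF// !mul1r; lra.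
(* The least admissible slope is the supremum of the lower quotients. *)
pose A := [set (dot xi v - F (v - s *: e)) / s | v in W & s in [set s : R | 0 < s]].
have supA : has_sup A.
  split; first by eexists; exists 0 => //; exists 1 => //=.
  exists ((F (0 + 1 *: e) - dot xi 0) / 1) => _ [v Wv [s s0 <-]].
  exact: sep.
exists (sup A) => v s Wv.
have [s0|s0|<-] := ltgtP 0 s.
- rewrite -lerBrDl -ler_pdivlMr//; apply: ge_sup; first by case: supA.
  by move=> _ [v' Wv' [s' s'0 <-]]; exact: sep.
- have h : (dot xi v - F (v - (- s) *: e)) / (- s) <= sup A.
    by apply: ub_le_sup; [case: supA|exists v => //; exists (- s) => //=; rewrite oppr_gt0].
  move: h; rewrite ler_pdivrMr ?oppr_gt0// scaleNr opprK; lra.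
- by rewrite mulr0 addr0 scale0r addr0 Wxi.
Qed.

(** Finite-dimensional Hahn-Banach: the functional is extended one coordinate at
    a time. *)
Lemma convex_linear_minorant F :
  (forall x z (t : R), 0 <= t <= 1 ->
    F (t *: x + (1 - t) *: z) <= t * F x + (1 - t) * F z) ->
  F 0 = 0 -> exists xi, forall v, dot xi v <= F v.
Proof.
move=> cF F0.
suff ext m : (m <= n)%N -> exists xi, forall v,
    (forall i : 'I_n, (m <= i)%N -> v 0 i = 0) -> dot xi v <= F v.
  have [xi h] := ext n (leqnn n).
  by exists xi => v; apply: h => i; rewrite leqNgt ltn_ord.
elim: m => [_|m ih mn].
  by exists 0 => v v0; rewrite (_ : v = 0) ?dot0r ?F0//; apply/rowP => i; rewrite v0// mxE.
have [xi xiP] := ih (ltnW mn).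
pose i0 := Ordinal mn.
have [|x z a b Wx Wz i mi|a aP] := @extend_minorant F xi (delta_mx 0 i0)
  [set v | forall i : 'I_n, (m <= i)%N -> v 0 i = 0] cF _ _ xiP.
- by move=> i _; rewrite mxE.
- by rewrite !mxE Wx// Wz// !mulr0 addr0.
(* Only the coordinate i0 of xi changes: it becomes the new slope a. *)
exists (xi + (a - xi 0 i0) *: delta_mx 0 i0) => v vm.
have := aP (v - v 0 i0 *: delta_mx 0 i0) (v 0 i0).
rewrite addrNK => h; apply: le_trans (h _); last first.
  move=> i; rewrite leq_eqVlt => /orP[/eqP mi|mi].
    by have -> : i = i0 by [apply/val_inj]; rewrite !mxE !eqxx mulr1 subrr.
  have ii0 : (i == i0) = false.
    by apply/negbTE/eqP => ii; rewrite ii ltnn in mi.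
  by rewrite !mxE (vm i mi) ii0 andbF mulr0 subr0.
by rewrite !dotE dotC (dotC (delta_mx _ _)) !dot_delta; lra.
Qed.

Lemma subdiff_nonempty s x :
  (forall u v (t : R), 0 <= t <= 1 ->
    s (t *: u + (1 - t) *: v) <= t * s u + (1 - t) * s v) ->
  subdiff s x !=set0.
Proof.
move=> cs; have [||xi h] := @convex_linear_minorant (fun v => s (x + v) - s x).
- move=> u v t t01; have := cs (x + u) (x + v) t t01.
  rewrite (_ : t *: (x + u) + _ = x + (t *: u + (1 - t) *: v)); last first.
    by apply/rowP => i; rewrite !mxE; ring.
  lra.
- by rewrite addr0 subrr.
- by exists xi => z; have := h (z - x); rewrite subrKC; lra.
Qed.

End Subgradient.

(** * Smooth convex functions *)

Section Smooth.
Context {R : realType} {n : nat}.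
Implicit Types (s : 'rV[R]_n -> R) (u v w x z d : 'rV[R]_n).

Lemma derive_gradient s x d : differentiable s x ->
  'D_d s x = dot (gradient s x) d.
Proof.
move=> ds; rewrite deriveE// {1}(row_sum_delta d) linear_sum /dot.
by apply: eq_bigr => i _; rewrite linearZ /= mxE deriveE// mulrC.
Qed.

Lemma is_derive_line s x d (t : R) : differentiable s (x + t *: d) ->
  is_derive t 1 (fun r : R => s (x + r *: d)) (dot (gradient s (x + t *: d)) d).
Proof.
move=> ds; rewrite -derive_gradient//.
have E : (fun h : R => h^-1 *: (((fun r : R => s (x + r *: d)) \o shift t) (h *: 1) -
           s (x + t *: d))) =
         (fun h : R => h^-1 *: ((s \o shift (x + t *: d)) (h *: d) - s (x + t *: d))).
  apply/funext => h /=; congr (_ *: (s _ - _)).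
  by rewrite [h *: 1]mulr1 scalerDl addrCA addrA.
have dv : derivable s (x + t *: d) d by exact: diff_derivable.
by split; rewrite /derivable /derive E.
Qed.

(** The mean value theorem for t |-> s(x + t d) - t <grad s(x), d> - b t^2. The
    free quadratic term b lets one statement give both the upper and the lower
    quadratic bound below. *)
Lemma taylor_mvt s x d (b : R) : (forall u, differentiable s u) ->
  exists2 t : R, 0 < t < 1 & s (x + d) - s x - dot (gradient s x) d - b =
    dot (gradient s (x + t *: d) - gradient s x) d - 2 * b * t.
Proof.
move=> ds.
pose a := dot (gradient s x) d.
pose h (t : R) := s (x + t *: d) - (a * t + b * t ^+ 2).
have dh (t : R) : is_derive t 1 h (dot (gradient s (x + t *: d)) d - (a + 2 * b * t)).
  have := is_derive_line (ds (x + t *: d)) => dl.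
  apply: is_deriveB.
  apply: is_derive_eq.
  rewrite /GRing.scale /= !mulr1. ring.
have [|t t01 ht] := @MVT R h _ 0 1 ltr01 (fun t _ => dh t).
  by apply: derivable_within_continuous => t _; case: (dh t).
exists t; first by move: t01; rewrite in_itv.
move: ht; rewrite /h scale0r scale1r addr0 !dotE /a; lra.
Qed.

(** The lower half serves for the tangent inequality, the upper half is the
    descent lemma. *)
Lemma smooth_quadratic_bound s L x z : smooth_convex s L ->
  `|s z - s x - dot (gradient s x) (z - x)| <= L / 2 * enorm (z - x) ^+ 2.
Proof.
case=> _ ds _ lip; set d := z - x.
have grow (t : R) : 0 < t < 1 ->
    `|dot (gradient s (x + t *: d) - gradient s x) d| <= L * t * enorm d ^+ 2.
  move=> /andP[t0 t1].
  have lt : enorm (gradient s (x + t *: d) - gradient s x) <= L * (t * enorm d).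
    by apply: le_trans (lip _ _) _; rewrite addrC addKr enormZ gtr0_norm.
  rewrite ler_norml lerNl -dotNl; apply/andP; split;
    apply: le_trans (cauchy_schwarz _ _) _; rewrite ?enormN;
    apply: le_trans (ler_wpM2r (enorm_ge0 _) lt) _; lra.
have -> : z = x + d by rewrite subrKC.
rewrite ler_norml; apply/andP; split.
- have [t t01 h] := @taylor_mvt s x d (- (L / 2 * enorm d ^+ 2)) ds.
  have := grow t t01; rewrite ler_norml => /andP[g _]; lra.
- have [t t01 h] := @taylor_mvt s x d (L / 2 * enorm d ^+ 2) ds.
  have := grow t t01; rewrite ler_norml => /andP[_ g]; lra.
Qed.

Lemma descent_lemma s L x z : smooth_convex s L ->
  s z <= s x + dot (gradient s x) (z - x) + L / 2 * enorm (z - x) ^+ 2.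
Proof.
by move=> /smooth_quadratic_bound-/(_ x z); rewrite ler_norml => /andP[_]; lra.
Qed.

(** Replaces the limit t -> 0+ in first-order conditions. *)
Lemma ge0_small (a b : R) :
  (forall t, 0 < t <= 1 -> 0 <= a + t * b) -> 0 <= a.
Proof.
move=> h; rewrite leNgt; apply/negP => a0.
have [b0|b0] := leP b 0.
  by have := h 1; rewrite ltr01 lexx => /(_ isT); lra.
have t0 : 0 < - a / (- a + b) by rewrite divr_gt0; lra.
have := h (- a / (- a + b)); rewrite t0 ler_pdivrMr /=; last lra.
have -> : a + - a / (- a + b) * b = a * (- a / (- a + b)).
  by field; rewrite gt_eqF; lra.
by rewrite pmulr_lge0// => h'; have := h' _; lra.
Qed.

(** Compares the convex upper bound of s(x + t(z - x)) with its quadratic lower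
    bound and lets t tend to 0. *)
Lemma gradient_inequality s L x z : smooth_convex s L ->
  s x + dot (gradient s x) (z - x) <= s z.
Proof.
move=> sm; rewrite -subr_ge0.
apply: (@ge0_small _ (L / 2 * enorm (z - x) ^+ 2)) => t /andP[t0 t1].
have [cs _ _ _] := sm.
have := @convex_segment _ _ s z x t cs; rewrite t1 ltW// => /(_ isT).
have -> : t *: z + (1 - t) *: x = x + t *: (z - x).
  by apply/rowP => i; rewrite !mxE; ring.
have := @smooth_quadratic_bound s L x (x + t *: (z - x)) sm.
rewrite [x + _]addrC addrK ler_norml enormZ gtr0_norm// dotZr => /andP[h _] h'.
by rewrite -(pmulr_rge0 _ t0); lra.
Qed.

End Smooth.

(** * Proximal operator and the proximal gradient step *)

Section Existence.
Context {R : realType}.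

Lemma ereal_between (x y : \bar R) : (x < y)%E ->
  exists r : R, (x < r%:E < y)%E.
Proof.
case: x y => [x| |] [y| |] //; rewrite ?lte_fin => xy.
- by exists ((x + y) / 2); rewrite !lte_fin; apply/andP; split; lra.
- by exists (x + 1); rewrite lte_fin ltry ltrDl ltr01.
- by exists (y - 1); rewrite lte_fin ltNyr /= ltrBlDr ltrDl ltr01.
- by exists 0; rewrite ltNyr ltry.
Qed.

(** The sublevel sets above the infimum generate a proper filter on K; by lower
    semicontinuity any cluster point of it is a minimizer. *)
Lemma lsc_compact_min (T : topologicalType) (K : set T) (F : T -> \bar R) :
  compact K -> K !=set0 -> lower_semicontinuous F ->
  exists2 u, K u & forall v, K v -> (F u <= F v)%E.
Proof.
move=> cK [k0 Kk0] lF; pose m := ereal_inf (F @` K).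
have mF v : K v -> (m <= F v)%E by move=> Kv; apply: ereal_inf_lbound; exists v.
have [moo|mfin] := eqVneq m +oo%E.
  exists k0 => // v /mF; rewrite moo leye_eq => /eqP ->; exact: leey.
pose D := [set r : R | (m < r%:E)%E].
pose G := filter_from D (fun r => K `&` [set u | (F u <= r%:E)%E]).
have [r0 Dr0] : D !=set0.
  have [|r /andP[mr _]] := @ereal_between m +oo%E; last by exists r.
  by rewrite lt_neqAle mfin leey.
have GF : ProperFilter G.
  apply: filter_from_proper; last first.
    by move=> r /ereal_inf_lt[_ [k Kk <-] /ltW Fk]; exists k.
  apply: filter_from_filter; first by exists r0.
  move=> r r' Dr Dr'; exists (Num.min r r').
    by rewrite /D /= EFin_min lt_min Dr.
  by move=> u [Ku]; rewrite /= EFin_min le_min => /andP[].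
have [|u [Ku clu]] := cK G GF; first by exists r0 => // u [].
exists u => // v Kv; apply: le_trans (mF v Kv).
rewrite leNgt; apply/negP => mu.
have [r /andP[mr ru]] := ereal_between mu.
have [V nV VF] := lF u r ru.
have [w [[Kw Fw] Vw]] : K `&` [set u | (F u <= r%:E)%E] `&` V !=set0.
  by apply: clu => //; exists r.
by have := VF w Vw; rewrite ltNge Fw.
Qed.
End Existence.

Section Prox.
Context {R : realType} {n : nat}.
Implicit Types (s q : 'rV[R]_n -> R) (h g : 'rV[R]_n -> \bar R).
Implicit Types (u v w x y z : 'rV[R]_n) (t : R).

Definition affine_minorant h :=
  exists (a : R) (b : 'rV[R]_n), forall u, ((a + dot b u)%:E <= h u)%E.

Lemma continuous_enorm_sqr w : continuous (fun u => enorm (u - w) ^+ 2).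
Proof.
have -> : (fun u => enorm (u - w) ^+ 2) =
          (fun u => \sum_(i < n) (u 0 i - w 0 i) * (u 0 i - w 0 i)).
  by apply/funext => u; rewrite enorm_sqr; apply: eq_bigr => i _; rewrite !mxE.
apply: continuous_big => [|i _]; first exact: add_continuous.
move=> u.
have c : {for u, continuous (fun v : 'rV[R]_n => v 0 i - w 0 i)}.
  by apply: continuousB; [exact: coord_continuous|exact: cst_continuous].
exact: (continuousM c c).
Qed.

Definition prox_obj t h w u : \bar R :=
  (t%:E * h u + (2^-1 * enorm (u - w) ^+ 2)%:E)%E.

(** The pointwise sum of a lower semicontinuous function without the value -oo
    and a continuous one; the slack in a < t h(x) + q(x) is split between the
    two. *)
Lemma lsc_prox_obj t h w : 0 < t -> (forall u, h u != -oo%E) ->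
  lower_semicontinuous h -> lower_semicontinuous (prox_obj t h w).
Proof.
move=> t0 hN lh x a ax.
pose q u := 2^-1 * enorm (u - w) ^+ 2.
have cq : {for x, continuous q}.
  by apply: continuousM; [exact: cst_continuous|exact: continuous_enorm_sqr].
have /ereal_between[b /andP[ab bx]] : (((a - q x) / t)%:E < h x)%E.
  move: ax (hN x); rewrite /prox_obj; case: (h x) => [r| |]//; last first.
    by rewrite ltry.
  by rewrite -EFinM -EFinD !lte_fin ltr_pdivrMr// /q => ? _; lra.
have [V nV Vb] := lh x b bx.
have e0 : 0 < t * b - (a - q x).
  by move: ab; rewrite lte_fin ltr_pdivrMr//; lra.
exists (V `&` [set u | `|q x - q u| < t * b - (a - q x)]).
  apply: filterI => //.
  by move/cvgrPdist_lt: cq => /(_ _ e0).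
move=> u [Vu /=]; rewrite ltr_norml => /andP[_ qu].
have := Vb u Vu; rewrite /prox_obj; move: (hN u); case: (h u) => [r| |]// _.
  rewrite lte_fin => br; rewrite -EFinM -EFinD lte_fin -/(q u).
  by have := ler_wpM2l (ltW t0) (ltW br); lra.
by move=> _; rewrite gt0_muley ?lte_fin// addye// ltry.
Qed.

Lemma compact_ball w (r : R) : compact [set u | enorm (u - w) <= r].
Proof.
have [r0|r0] := leP 0 r; last first.
  rewrite (_ : mkset _ = set0); first exact: compact0.
  apply/seteqP; split => // u /= ur.
  by have := enorm_ge0 (u - w); rewrite leNgt (le_lt_trans ur r0).
apply: bounded_closed_compact.
  exists (r + enorm w); split; first exact: num_real.
  move=> M rM u /= ur; apply: le_trans (norm_le_enorm _) _.
  apply: le_trans (ltW rM); rewrite -[u in leLHS](subrK w).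
  by apply: le_trans (enormD _ _) _; rewrite lerD2r.
rewrite (_ : mkset _ = (fun u => enorm (u - w) ^+ 2) @^-1` [set a | a <= r ^+ 2]).
  apply: closed_comp => [u _|]; first exact: continuous_enorm_sqr.
  exact: closed_le.
by apply/seteqP; split=> u /=; rewrite ler_pXn2r ?nnegrE ?enorm_ge0.
Qed.

(** The quadratic term dominates the affine minorant. *)
Lemma prox_obj_coercive t h w : 0 < t -> affine_minorant h ->
  forall M : R, exists r : R, forall u, r <= enorm (u - w) ->
    (M%:E <= prox_obj t h w u)%E.
Proof.
move=> t0 [a [b hab]] M.
pose C := t * (a + dot b w).
(* For p = |u - w| beyond this radius, p^2/2 >= p t|b| + p and p >= |M - C|. *)
exists (2 * (t * enorm b) + 2 + `|M - C|) => u ru.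
apply: (@le_trans _ _ (t%:E * (a + dot b u)%:E + (2^-1 * enorm (u - w) ^+ 2)%:E)%E).
  rewrite -EFinM -EFinD lee_fin.
  have bu : - (enorm b * enorm (u - w)) <= dot b u - dot b w.
    by have := cauchy_schwarz (- b) (u - w); rewrite enormN !dotE; lra.
  have tbu := ler_wpM2l (ltW t0) bu.
  have be := mulr_ge0 (ltW t0) (enorm_ge0 b).
  have MC := ler_norm (M - C); have MC0 := normr_ge0 (M - C).
  move: (enorm (u - w)) ru tbu => p ru tbu.
  have p0 : 0 <= p by lra.
  have := ler_wpM2l p0 ru; rewrite /C in MC MC0 *.
  have := mulr_ge0 p0 MC0.
  lra.
by rewrite leeD2r// lee_pmul2l ?lte_fin.
Qed.

Lemma prox_argmin t h w : 0 < t -> proper_fun h -> lower_semicontinuous h ->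
  affine_minorant h -> argmin [set: 'rV[R]_n] (prox_obj t h w) (prox t h w).
Proof.
move=> t0 [hN [u0 hu0]] lh am; apply: getPex.
have hu0f : h u0 \is a fin_num by rewrite fin_numE hN hu0.
pose M := fine (prox_obj t h w u0).
have ME : prox_obj t h w u0 = M%:E.
  by rewrite /M /prox_obj -(fineK hu0f).
have [r rP] := prox_obj_coercive w t0 am M.
(* Outside the ball K the objective exceeds its value at u0, which lies in K. *)
pose K := [set u | enorm (u - w) <= Num.max r (enorm (u0 - w))].
have K0 : K !=set0 by exists u0; rewrite /K /= le_max lexx orbT.
have [u Ku uP] := lsc_compact_min (@compact_ball w _) K0 (@lsc_prox_obj t h w t0 hN lh).
exists u; split => // v _.
have [|] := leP (enorm (v - w)) (Num.max r (enorm (u0 - w))); first exact: uP.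
rewrite gt_max => /andP[/ltW /rP vM _]; apply: le_trans vM.
by rewrite -ME; apply: uP; rewrite /= le_max lexx orbT.
Qed.

End Prox.

Section Optimality.
Context {R : realType} {n : nat}.
Implicit Types (s q : 'rV[R]_n -> R) (h g : 'rV[R]_n -> \bar R).
Implicit Types (u v w x y z : 'rV[R]_n) (t l : R).

(** First-order condition at a minimizer u of t h + q, where q is only required
    to have a second-order upper expansion from u towards z, with first-order
    coefficient A. It is used with q = f, to produce an affine minorant of g, and
    with q the squared distance, for the proximal point. *)
Lemma minimizer_first_order h q t u z (A B : R) : 0 < t ->
  (forall v, h v != -oo%E) -> convex_efun h ->
  h u \is a fin_num -> h z \is a fin_num ->
  (forall v, (t%:E * h u + (q u)%:E <= t%:E * h v + (q v)%:E)%E) ->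
  (forall r, 0 < r <= 1 -> q (u + r *: (z - u)) <= q u + r * A + r ^+ 2 * B) ->
  t * fine (h u) <= t * fine (h z) + A.
Proof.
move=> t0 hN ch hu hz umin qA; rewrite -subr_ge0.
apply: (@ge0_small _ _ B) => r /andP[r0 r1].
have r01 : 0 <= r <= 1 by rewrite ltW.
have := ch z u r r01; have := umin (u + r *: (z - u)).
have := qA r; rewrite r0 r1 => /(_ isT).
have -> : u + r *: (z - u) = r *: z + (1 - r) *: u.
  by apply/rowP => i; rewrite !mxE; ring.
rewrite -(fineK hu) -(fineK hz); move: (hN (r *: z + (1 - r) *: u)).
case: (h (r *: z + (1 - r) *: u)) => [p| |]//= _.
rewrite -!EFinM -!EFinD !lee_fin => qr up pc.
have := ler_wpM2l (ltW t0) pc.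
move: qr up.
move: (q _) => q1; move: (q _) => q2 qr up tpc.
rewrite -(pmulr_rge0 _ r0); lra.
Qed.

Lemma argmin_fin_num h q t u : 0 < t -> proper_fun h ->
  argmin [set: 'rV[R]_n] (fun v => t%:E * h v + (q v)%:E)%E u ->
  h u \is a fin_num.
Proof.
move=> t0 [hN [v hv]] [_ /(_ v)]; rewrite fin_numE hN /=.
have /fineK <- : h v \is a fin_num by rewrite fin_numE hN.
apply: contraPneq => ->; rewrite gt0_muley ?lte_fin// addye//.
by rewrite -EFinM -EFinD leye_eq => /(_ I).
Qed.

Lemma inner_solsE s h u : inner_sols s h u ->
  argmin [set: 'rV[R]_n] (fun v => 1%:E * h v + (s v)%:E)%E u.
Proof.
by move=> [_ umin]; split=> // v _; rewrite !mul1e addeC [leRHS]addeC; exact: umin.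
Qed.

Lemma inner_sols_fin_num s h u : proper_fun h -> inner_sols s h u ->
  h u \is a fin_num.
Proof. by move=> ph /inner_solsE; exact: argmin_fin_num. Qed.

(** At a minimizer u of s + h, the vector - grad s(u) is a subgradient of h. *)
Lemma inner_sols_affine_minorant s L h u : smooth_convex s L ->
  proper_lsc_convex h -> inner_sols s h u -> affine_minorant h.
Proof.
move=> sm [ph _ ch] us; have hu := inner_sols_fin_num ph us.
exists (fine (h u) + dot (gradient s u) u), (- gradient s u) => z.
have [hN _] := ph.
have [hz|] := boolP (h z \is a fin_num); last first.
  by rewrite fin_numE hN /= negbK => /eqP ->; exact: leey.
have /inner_solsE[_ umin] := us.
have sub (r : R) : 0 < r <= 1 -> s (u + r *: (z - u)) <=
    s u + r * dot (gradient s u) (z - u) + r ^+ 2 * (L / 2 * enorm (z - u) ^+ 2).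
  move=> /andP[r0 _]; have := descent_lemma u (u + r *: (z - u)) sm.
  rewrite [u + _]addrC addrK dotZr enormZ gtr0_norm//; lra.
have := minimizer_first_order ltr01 hN ch hu hz (fun v => umin v I) sub.
rewrite -(fineK hz) lee_fin !dotE; lra.
Qed.

Lemma prox_first_order t h w z : 0 < t -> proper_lsc_convex h ->
  affine_minorant h -> h z \is a fin_num ->
  let y := prox t h w in
  h y \is a fin_num /\ t * fine (h y) <= t * fine (h z) + dot (y - w) (z - y).
Proof.
move=> t0 [ph lh ch] am hz y.
have ymin := prox_argmin w t0 ph lh am; rewrite -/y in ymin.
have hy : h y \is a fin_num by apply: argmin_fin_num ymin.
split=> //; have [hN _] := ph; have [_ ym] := ymin.
apply: (@minimizer_first_order h _ t y z _ (2^-1 * enorm (z - y) ^+ 2) t0 hN ch hy hz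
  (fun v => ym v I)) => r _.
rewrite !enorm_sqr.
have -> : y + r *: (z - y) - w = (y - w) + r *: (z - y) by rewrite addrAC.
move: (y - w) (z - y) => a b; rewrite !dotE (dotC b a); lra.
Qed.

(** The three-point inequality of the proximal gradient step. The
    comparison point z is left free because two choices matter: the optimum x'
    and the previous point y_(k-1). *)
Lemma prox_grad_decrease s L h l x z : smooth_convex s L ->
  proper_lsc_convex h -> affine_minorant h -> 0 < l ->
  backtrack_test s h l x -> h z \is a fin_num ->
  let y := prox_grad l^-1 s h x in
  h y \is a fin_num /\
  (s y + fine (h y)) - (s z + fine (h z)) <=
    l / 2 * (enorm (z - x) ^+ 2 - enorm (z - y) ^+ 2).
Proof.
move=> sm ph am l0 bt hz y.
have li : 0 < l^-1 by rewrite invr_gt0.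
have [hy yP] := @prox_first_order _ _ (x - l^-1 *: gradient s x) z li ph am hz.
split=> //; move: bt; rewrite /backtrack_test -/y => bt.
have gi := gradient_inequality x z sm.
move: hy yP bt gi; rewrite -/(prox_grad l^-1 s h x) -/y => _.
have -> : y - (x - l^-1 *: gradient s x) = (y - x) + l^-1 *: gradient s x.
  by rewrite opprB addrCA addrC.
have -> : z - x = (y - x) + (z - y) by rewrite [RHS]addrC addrA subrK.
move: (y - x) (z - y) (gradient s x) => a b d.
rewrite !enorm_sqr -(ler_pM2l l0) mulrDr !dotE (dotC b a) !mulrDr !mulrA.
rewrite divff ?gt_eqF// !mul1r; lra.
Qed.

End Optimality.

(** * Real sequences: step sizes and rates *)

Section Rates.
Context {R : realType}.

(** By contradiction: if e > K a with K = 4 Lb (D1 + D2)^2, then the first bound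
    on e gives s >= 4 a (D1 + 2 D2), hence l s (s/2 - a D2) >= 2 a e, and the
    second bound gives e <= e' - 2 a e < (K a + 2 K a^2) - 2 K a^2. *)
Lemma rate_step (e e' s l Lb D1 D2 a eta : R) :
  0 < l <= Lb -> 0 < D1 -> 0 < D2 -> 0 <= s -> 0 < a -> eta <= a ->
  e <= l * (s * D1 - s ^+ 2 / 2) ->
  e <= e' + l * (s * (eta * D2) - s ^+ 2 / 2) ->
  e' <= 4 * Lb * (D1 + D2) ^+ 2 * (a + 2 * a ^+ 2) ->
  e <= 4 * Lb * (D1 + D2) ^+ 2 * a.
Proof.
move=> /andP[l0 lLb] D10 D20 s0 a0 etaa e1 e2 e'K.
set K := 4 * Lb * _ in e'K *; rewrite leNgt; apply/negP => Ke.
have ls0 : 0 <= l * s by apply: mulr_ge0 => //; exact: ltW.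
have elsD : e <= l * s * D1.
  by apply: le_trans e1 _; have := mulr_ge0 (ltW l0) (sqr_ge0 s); lra.
have sD : 4 * a * (D1 + 2 * D2) <= s.
  rewrite leNgt; apply/negP => sD.
  have : l * s * D1 <= l * (4 * a * (D1 + 2 * D2)) * D1.
    by apply: (ler_wpM2r (ltW D10)); apply: (ler_wpM2l (ltW l0)); exact: ltW.
  have : l * (4 * a * (D1 + 2 * D2)) * D1 <= Lb * (4 * a * (D1 + 2 * D2)) * D1.
    apply: (ler_wpM2r (ltW D10)); apply: (ler_wpM2r _ lLb).
    by rewrite !mulr_ge0//; lra.
  have : 0 <= Lb * a * D2 ^+ 2 by rewrite !mulr_ge0 ?sqr_ge0//; lra.
  by move: Ke; rewrite /K; lra.
have h1 : l * s * (s / 2 - a * D2) >= l * s * (2 * a * D1).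
  by rewrite ler_wpM2l//; have := mulr_ge0 (ltW a0) (ltW D20); lra.
have h2 : 2 * a * e <= 2 * a * (l * s * D1) by rewrite ler_wpM2l//; lra.
have h3 : l * s * D2 * eta <= l * s * D2 * a 
  by apply: ler_wpM2l => //; apply: mulr_ge0 => //; exact: ltW.
have h4 : 2 * a * (K * a) < 2 * a * e by rewrite ltr_pM2l ?mulr_gt0.
lra.
Qed.

(** With p = (k+1)^al and q = (k+2)^al the claim is q (q - p) <= 2 p. It follows
    from q - p <= p/(k+1), as al <= 1, and q <= k + 2 <= 2 (k + 1). *)
Lemma powR_step (al : R) (k : nat) : 0 < al <= 1 ->
  k.+1%:R `^ (- al) <= k.+2%:R `^ (- al) + 2 * (k.+2%:R `^ (- al)) ^+ 2 :> R.
Proof.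
move=> /andP[al0 al1]; rewrite !powRN.
set p := k.+1%:R `^ al; set q := k.+2%:R `^ al.
have p0 : 0 < p by rewrite powR_gt0.
have q0 : 0 < q by rewrite powR_gt0.
have k0 : 0 < k.+1%:R :> R by [].
have qk : q <= 2 * k.+1%:R.
  apply: (@le_trans _ _ (k.+2%:R `^ 1)).
    by rewrite ler_powR// ler1n.
  by rewrite powRr1// -!natrM ler_nat mul2n -addnn addSnnS leq_addl.
have qp : q - p <= p / k.+1%:R.
  have -> : q = p * (k.+2%:R / k.+1%:R) `^ al.
    by rewrite -powRM// mulrC divfK// gt_eqF.
  have h : (k.+2%:R / k.+1%:R) `^ al <= k.+2%:R / k.+1%:R :> R.
    rewrite -[leRHS]powRr1; last by rewrite divr_ge0.
    by rewrite ler_powR// ler_pdivlMr// mul1r ler_nat.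
  have := ler_wpM2l (ltW p0) h.
  have -> : k.+2%:R / k.+1%:R = 1 + k.+1%:R^-1 :> R.
    by rewrite -natr1 mulrDl divff ?gt_eqF// mul1r.
  by rewrite [p * (1 + _)]mulrDr mulr1 lerBlDl.
have qq : q * (q - p) <= 2 * p.
  apply: (@le_trans _ _ (q * (p / k.+1%:R))); first by rewrite ler_wpM2l// ltW.
  rewrite mulrA ler_pdivrMr//.
  by have := ler_wpM2r (ltW p0) qk; lra.
have -> : p^-1 = q ^+ 2 / (p * q ^+ 2) by field; rewrite !gt_eqF.
have -> : q^-1 + 2 * q^-1 ^+ 2 = (p * q + 2 * p) / (p * q ^+ 2).
  by field; rewrite !gt_eqF.
by rewrite ler_pM2r ?invr_gt0 ?mulr_gt0 ?exprn_gt0//; lra.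
Qed.

(** Each of the k+1 terms is at most (k+1)^(- 2 al) <= 1/(k+1). *)
Lemma sum_eta_sqr (c al : R) k : 0 < c <= 1 -> 1 / 2 < al ->
  \sum_(i < k.+1) bisg_eta c al (k + i) ^+ 2 <= 1.
Proof.
move=> /andP[c0 c1] al2.
apply: (@le_trans _ _ (\sum_(i < k.+1) k.+1%:R^-1)); last first.
  by rewrite sumr_const card_ord -[_ *+ _]mulr_natl divff.
apply: ler_sum => i _; rewrite /bisg_eta.
have h : c * (k + i).+1%:R `^ (- al) <= k.+1%:R `^ (- al).
  rewrite -[leRHS]mul1r; apply: ler_pM => //; [exact: ltW|].
  rewrite !powRN lef_pV2 ?posrE ?powR_gt0//.
  by rewrite ge0_ler_powR ?nnegrE ?ler_nat ?ltnS ?leq_addr//; lra.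
apply: (@le_trans _ _ ((k.+1%:R `^ (- al)) ^+ 2)).
  by rewrite ler_pXn2r ?nnegrE ?powR_ge0// mulr_ge0 ?powR_ge0// ltW.
rewrite -powR_mulrn ?powR_ge0// -powRrM -powR_inv1// ler_powR ?ler1n//; lra.
Qed.

(** Each of the k+1 terms is at least c (2k+1)^(-al) >= c (k+1)^(-al)/2. *)
Lemma sum_eta (c al : R) k : 0 < c -> 0 < al < 1 ->
  c * k%:R `^ (1 - al) / 2 <= \sum_(i < k.+1) bisg_eta c al (k + i).
Proof.
move=> c0 /andP[al0 al1]; rewrite /bisg_eta -mulr_sumr -mulrA ler_pM2l//.
apply: (@le_trans _ _ (\sum_(i < k.+1) (k.*2.+1)%:R `^ (- al))); last first.
  apply: ler_sum => i _; rewrite !powRN lef_pV2 ?posrE ?powR_gt0//.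
  rewrite (ge0_ler_powR (ltW al0)) ?nnegrE// ler_nat ltnS -addnn leq_add2l.
  by rewrite -ltnS ltn_ord.
rewrite sumr_const card_ord -[leRHS]mulr_natl powRN.
rewrite ler_pdivlMr ?powR_gt0//.
apply: (@le_trans _ _ (k.+1%:R `^ (1 - al) / 2 * (2 * k.+1%:R `^ al))); last first.
  by rewrite mulrA divfK// -powRD ?subrK ?powRr1// pnatr_eq0 implybT.
rewrite ler_pM ?mulr_ge0 ?powR_ge0//.
  by rewrite ler_wpM2r// ge0_ler_powR ?nnegrE ?ler_nat//; lra.
apply: (@le_trans _ _ ((2 * k.+1%:R) `^ al)).
  rewrite -natrM mul2n doubleS ge0_ler_powR ?nnegrE// ?ler_nat//.
  exact: ltW.
rewrite powRM// ler_wpM2r ?powR_ge0//.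
rewrite -[leRHS]powRr1//; apply: ler_powR; last exact: ltW.
by rewrite ler1n.
Qed.

(** Telescoping over the window k <= j <= 2k. S stands for the
    closed-form lower bound of the total weight; replacing the weights by it is
    sound only for v >= 0, and for v < 0 the claim is trivial. *)
Lemma weighted_average_bound (A w eta : nat -> R) (v B1 B2 S : R) k :
  (forall j, 0 <= eta j) -> (forall j, 0 <= A j <= B1) -> 0 <= B2 ->
  (forall j, 2 * eta j * w j <= A j - A j.+1 + 2 * eta j ^+ 2 * B2) ->
  (forall j, (k <= j <= 2 * k)%N -> v <= w j) ->
  \sum_(i < k.+1) eta (k + i)%N ^+ 2 <= 1 ->
  0 <= S <= \sum_(i < k.+1) eta (k + i)%N ->
  2 * S * v <= B1 + 2 * B2.
Proof.
move=> eta0 AB B20 step vw s2 /andP[S0 S1].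
have [B10 _] := andP (AB 0); have [_ B11] := andP (AB 0).
have [v0|v0] := leP v 0.
  by apply: (@le_trans _ _ 0); [rewrite mulr_ge0_le0// mulr_ge0|lra].
apply: (@le_trans _ _ (\sum_(i < k.+1) 2 * eta (k + i)%N * w (k + i)%N)).
  rewrite -mulrA [leRHS](eq_bigr (fun i : 'I_k.+1 => 2 * (eta (k + i)%N * w (k + i)%N))).
    rewrite -mulr_sumr ler_pM2l//; apply: (@le_trans _ _ (\sum_(i < k.+1) eta (k + i)%N * v)).
      by rewrite -mulr_suml ler_wpM2r// ltW.
    apply: ler_sum => i _; rewrite ler_wpM2l// vw// leq_addr/= mul2n -addnn leq_add2l.
    by rewrite -ltnS ltn_ord.
  by move=> i _; rewrite mulrA.
have tel m : \sum_(i < m) 2 * eta (k + i)%N * w (k + i)%N <=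
    A k - A (k + m)%N + 2 * (\sum_(i < m) eta (k + i)%N ^+ 2) * B2.
  elim: m => [|m ih]; first by rewrite !big_ord0 addn0; lra.
  by rewrite !big_ord_recr/= addnS; have := step (k + m)%N; lra.
apply: le_trans (tel _) _.
have /andP[_ ?] := AB k; have /andP[? _] := AB (k + k.+1)%N.
by have := ler_wpM2r B20 s2; lra.
Qed.

End Rates.

(** * The bilevel iteration *)

Section Algorithm.
Context {R : realType} {n : nat}.
Implicit Types (f s : 'rV[R]_n -> R) (g h : 'rV[R]_n -> \bar R).

Lemma backtrack_test_ge f Lf g l u : smooth_convex f Lf -> Lf <= l ->
  backtrack_test f g l u.
Proof.
move=> sm Ll; rewrite /backtrack_test; set T := prox_grad _ _ _ _.
apply: le_trans (descent_lemma u T sm) _; rewrite lerD2l.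
by apply: ler_wpM2r; [exact: sqr_ge0|lra].
Qed.

(** A rejected trial value l satisfies l < Lf by the descent lemma, so a last
    increase of L_k by the factor rho cannot exceed Lf rho. *)
Lemma step_rule_bounds f g Lf x (L : nat -> R) Lbar : smooth_convex f Lf ->
  0 < Lf -> step_rule f g Lf x L Lbar ->
  forall k, 0 < L k <= Lbar /\ backtrack_test f g (L k) (x k).
Proof.
move=> sm Lf0 [LE ->|gam rho gam0 rho1 [i iP] ->] k.
  by rewrite LE Lf0 lexx; split=> //; exact: backtrack_test_ge sm _.
have [_ bt _] := iP k; split=> //; clear bt.
have rho0 : 0 < rho by rewrite (lt_trans ltr01).
(* L_j inherits the bound from L_(j-1), the first index having gamma before it. *)
have next p j : 0 < p <= Num.max (Lf * rho) gam -> Lprev gam L j = p ->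
    0 < L j <= Num.max (Lf * rho) gam.
  move=> /andP[p0 pM] pE; have [-> _ fail] := iP j; rewrite pE in fail *.
  rewrite mulr_gt0 ?exprn_gt0//=; case: (i j) fail => [|m] fail.
    by rewrite expr0 mulr1.
  rewrite le_max; apply/orP; left; rewrite exprSr mulrA ler_pM2r// leNgt.
  apply/negP => /ltW lt; apply: (fail m (ltnSn m)).
  exact: backtrack_test_ge sm _.
elim: k => [|k ih]; first by apply: (next gam) => //; rewrite gam0 le_max lexx orbT.
exact: (next (L k)).
Qed.

(** Form of the decrease in which the dependence on z is only through its
    distance to x; |z - y|^2 is expanded around x. *)
Lemma sqr_dist_le (z x y : 'rV[R]_n) :
  enorm (z - x) ^+ 2 - enorm (z - y) ^+ 2 <=
  2 * (enorm (x - y) * enorm (z - x)) - enorm (x - y) ^+ 2.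
Proof.
have := cauchy_schwarz (- (x - y)) (z - x); rewrite enormN.
rewrite !enorm_sqr (_ : z - y = (z - x) + (x - y)); last by rewrite subrKA.
move: (x - y) (z - x) => a b; rewrite !dotE (dotC b a); lra.
Qed.

Lemma prox_grad_decrease_dist s L h l x y z : smooth_convex s L ->
  proper_lsc_convex h -> affine_minorant h -> 0 < l ->
  backtrack_test s h l x -> h z \is a fin_num ->
  y = prox_grad l^-1 s h x ->
  (s y + fine (h y)) - (s z + fine (h z)) <=
    l * (enorm (x - y) * enorm (z - x) - enorm (x - y) ^+ 2 / 2).
Proof.
move=> sm ph am l0 bt hz yE.
have [_ dec] := prox_grad_decrease sm ph am l0 bt hz.
rewrite -yE in dec; apply: le_trans dec _.
by have := ler_wpM2l (ltW l0) (sqr_dist_le z x y); lra.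
Qed.

Lemma outer_stepI (omega : 'rV[R]_n -> R) (xi x' x y : 'rV[R]_n) (eta D2 : R) :
  0 <= eta -> subdiff omega y xi -> enorm xi <= D2 ->
  enorm (y - x') <= enorm (x - x') ->
  2 * eta * (omega y - omega x') <=
    enorm (x - x') ^+ 2 - enorm (y - eta *: xi - x') ^+ 2 + 2 * eta ^+ 2 * D2 ^+ 2.
Proof.
move=> eta0 /(_ x') sub xiD yx.
have D20 : 0 <= D2 := le_trans (enorm_ge0 _) xiD.
have yx2 : enorm (y - x') ^+ 2 <= enorm (x - x') ^+ 2.
  by rewrite ler_pXn2r ?nnegrE ?enorm_ge0.
have xi2 : eta ^+ 2 * enorm xi ^+ 2 <= eta ^+ 2 * D2 ^+ 2.
  by rewrite ler_wpM2l ?sqr_ge0// ler_pXn2r ?nnegrE ?enorm_ge0.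
have := ler_wpM2l eta0 sub.
have p0 : 0 <= eta ^+ 2 * D2 ^+ 2 by rewrite mulr_ge0 ?sqr_ge0.
move: yx2 xi2; rewrite -[x' - y]opprB dotNr [y - _ - x']addrAC !enorm_sqr.
move: (y - x') => a; rewrite !dotE (dotC a xi); lra.
Qed.

(** The decrease inequality for sigma + psi controls omega at y - eta G, and the
    subgradient xi gives omega(y) - omega(y - eta G) <= eta |xi| |G|. This costs
    a second eta^2 D2^2 term compared with the explicit subgradient step. *)
Lemma outer_stepII (sigma psi : 'rV[R]_n -> R) Ls (xi x' x y : 'rV[R]_n) (eta D2 : R) :
  let omega z := sigma z + psi z in
  let G := grad_map eta sigma (EFin \o psi) y in
  smooth_convex sigma Ls -> 0 < Ls -> proper_lsc_convex (EFin \o psi) ->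
  0 < eta -> eta <= Ls^-1 -> subdiff omega y xi -> enorm xi <= D2 ->
  enorm G <= D2 -> enorm (y - x') <= enorm (x - x') ->
  2 * eta * (omega y - omega x') <=
    enorm (x - x') ^+ 2 - enorm (y - eta *: G - x') ^+ 2 + 2 * eta ^+ 2 * D2 ^+ 2.
Proof.
move=> omega G sm Ls0 ph eta0 etaL /(_ (y - eta *: G)) sub xiD GD yx.
have yx2 : enorm (y - x') ^+ 2 <= enorm (x - x') ^+ 2.
  by rewrite ler_pXn2r ?nnegrE ?enorm_ge0.
have am : affine_minorant (EFin \o psi).
  have [_ _ cpsi] := ph.
  have [|b bP] := @subdiff_nonempty _ _ psi 0.
    by move=> u v t t01; have := cpsi u v t t01; rewrite /= -!EFinM -EFinD lee_fin.
  by exists (psi 0), b => u; rewrite lee_fin; have := bP u; rewrite subr0.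
pose T := prox_grad eta sigma (EFin \o psi) y.
have TE : y - eta *: G = T.
  by rewrite /G /grad_map scalerA divff ?gt_eqF// scale1r subKr.
have ie0 : 0 < eta^-1 by rewrite invr_gt0.
have bt : backtrack_test sigma (EFin \o psi) eta^-1 y.
  by apply: backtrack_test_ge sm _; rewrite -[Ls]invrK lef_pV2 ?posrE ?invr_gt0.
have [_] := @prox_grad_decrease _ _ sigma Ls _ _ y x' sm ph am ie0 bt isT.
rewrite invrK -/T /= -(ler_pM2l eta0) !mulrA divff ?gt_eqF// => dec.
have := ler_wpM2l (ltW eta0) sub; rewrite TE /omega.
have : dot xi (y - T) <= eta * D2 ^+ 2.
  rewrite -TE subKr dotZr ler_pM2l// expr2.
  apply: le_trans (cauchy_schwarz _ _) _.
  by rewrite ler_pM ?enorm_ge0.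
move=> /(ler_wpM2l (ltW eta0)); move: dec yx2.
rewrite -[T - y]opprB dotNr -(enormN (x' - y)) -(enormN (x' - T)) !opprB; lra.
Qed.

Lemma bisg_outer_step (omega : 'rV[R]_n -> R) (eta : nat -> R) c Omega f g L x y x' D2 :
  convex_function [set: 'rV[R]_n] omega ->
  (forall k, 0 < eta k <= c) ->
  versionI omega c Omega \/
    (versionII omega c eta Omega /\
     forall k xi, subdiff omega (y k) xi -> enorm xi <= D2) ->
  bisg_iterates f g eta Omega L x y ->
  (forall k, enorm (Omega k (y k)) <= D2) ->
  (forall k, enorm (y k - x') <= enorm (x k - x')) ->
  forall k, 2 * eta k * (omega (y k) - omega x') <=
    enorm (x k - x') ^+ 2 - enorm (x k.+1 - x') ^+ 2 + 2 * eta k ^+ 2 * D2 ^+ 2.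
Proof.
move=> comega eta0 ver it OD yx k; have /andP[ek0 ekc] := eta0 k.
have [_ ->] := it k.
case: ver => [[_ [Om [sub _ OmE]]]|[[sigma [psi [Ls [omE [Ls0 sm] ph cL OmE]]]] subD]].
  by apply: outer_stepI (OD k) (yx k); [exact: ltW|rewrite OmE].
have [|xi xiP] := @subdiff_nonempty _ _ omega (y k).
  by move=> u v t; exact: convex_segment.
have := OD k; rewrite OmE => GD; rewrite !omE.
apply: (outer_stepII sm Ls0 ph ek0 _ _ (subD k xi xiP) GD (yx k)).
  by apply: le_trans ekc _; move: cL; rewrite le_min => /andP[].
by move=> z; rewrite -!omE; exact: xiP.
Qed.

(** Induction on k by [rate_step], with l = L_k, s = |x_k - y_k| and
    a = k^(-al). The index 0 is skipped, so the induction starts from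
    e_1 <= L_1 (s D1 - s^2/2) <= L_1 (D1 + D2)^2. *)
Lemma inner_rate f g Lf (eta : nat -> R) (al Lbar D1 D2 : R) Omega L x y x' :
  smooth_convex f Lf -> 0 < Lf -> proper_lsc_convex g ->
  step_rule f g Lf x L Lbar -> bisg_iterates f g eta Omega L x y ->
  inner_sols f g x' -> 0 < al <= 1 ->
  (forall k, 0 <= eta k <= k.+1%:R `^ (- al)) -> 0 < D1 -> 0 < D2 ->
  (forall k, enorm (x k - x') <= D1) -> (forall k, enorm (Omega k (y k)) <= D2) ->
  forall k, f (y k.+1) + fine (g (y k.+1)) - (f x' + fine (g x')) <=
    4 * Lbar * (D1 + D2) ^+ 2 * k.+1%:R `^ (- al).
Proof.
move=> sm Lf0 pg st it xs al01 etaP D10 D20 xD OD.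
have stP := step_rule_bounds sm Lf0 st.
have am := inner_sols_affine_minorant sm pg xs.
have gx' : g x' \is a fin_num by case: pg => pg _ _; exact: inner_sols_fin_num pg xs.
pose s k := enorm (x k - y k).
have yE k : y k = prox_grad (L k)^-1 f g (x k) by case: (it k).
have gy k : g (y k) \is a fin_num.
  have [/andP[L0 _] bt] := stP k.
  by have [] := prox_grad_decrease sm pg am L0 bt gx'; rewrite -yE.
pose e k := f (y k) + fine (g (y k)) - (f x' + fine (g x')).
have dec k z : g z \is a fin_num ->
    f (y k) + fine (g (y k)) - (f z + fine (g z)) <=
    L k * (s k * enorm (z - x k) - s k ^+ 2 / 2).
  have [/andP[L0 _] bt] := stP k.
  by move=> gz; exact: prox_grad_decrease_dist sm pg am L0 bt gz (yE k).
have s0 k : 0 <= s k by exact: enorm_ge0.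
have e1 k : e k <= L k * (s k * D1 - s k ^+ 2 / 2).
  apply: le_trans (dec k x' gx') _; have [/andP[L0 _] _] := stP k.
  rewrite ler_pM2l// lerD2r ler_wpM2l//.
  by rewrite -enormN opprB.
have e2 k : e k.+1 <= e k +
    L k.+1 * (s k.+1 * (eta k * D2) - s k.+1 ^+ 2 / 2).
  have [/andP[L0 _] _] := stP k.+1; have := dec k.+1 (y k) (gy k).
  have [_ xk] := it k; rewrite xk subKr enormZ.
  have /andP[eta0 _] := etaP k; rewrite ger0_norm//.
  have h : eta k * enorm (Omega k (y k)) <= eta k * D2 by rewrite ler_wpM2l.
  have := ler_wpM2l (mulr_ge0 (ltW L0) (s0 k.+1)) h; rewrite /e; lra.
rewrite -/e; elim=> [|k ih].
  rewrite powR1 mulr1; apply: le_trans (e1 1%N) _.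
  have [/andP[L0 LL] _] := stP 1%N.
  apply: (@le_trans _ _ (L 1%N * (D1 + D2) ^+ 2)).
    rewrite ler_pM2l//; have := sqr_ge0 (s 1%N - D1); have := mulr_gt0 D10 D20.
    have := sqr_ge0 D1; have := sqr_ge0 D2; lra.
  have := ler_wpM2r (sqr_ge0 (D1 + D2)) LL.
  have : 0 <= Lbar * (D1 + D2) ^+ 2 by rewrite mulr_ge0 ?sqr_ge0//; lra.
  lra.
have [LL _] := stP k.+2; have /andP[_ etak] := etaP k.+1.
apply: (rate_step LL D10 D20 (s0 _) _ etak (e1 _) (e2 _)); first by rewrite powR_gt0.
apply: le_trans ih _; rewrite ler_wpM2l ?powR_step//.
by rewrite mulr_ge0 ?sqr_ge0// mulr_ge0//; case/andP: LL => ? ?; lra.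
Qed.

End Algorithm.

Unset Implicit Arguments.

Theorem theorem3 (R : realType) (n : nat)
  (f : 'rV[R]_n -> R) (g : 'rV[R]_n -> \bar R) (omega : 'rV[R]_n -> R)
  (Lf : R) (c alpha : R)
  (Omega : nat -> 'rV[R]_n -> 'rV[R]_n) (L : nat -> R) (Lbar : R)
  (x y : nat -> 'rV[R]_n) (x' : 'rV[R]_n) (D1 D2 : R)
  (Lf_gt0 : 0 < Lf)
  (f_smooth : smooth_convex f Lf)
  (g_convex : proper_lsc_convex g)
  (inner_sols_neq0 : inner_sols f g !=set0)
  (omega_convex : convex_function [set: 'rV[R]_n] omega)
  (omega_coercive : coercive omega)
  (alpha_gt : 1 / 2 < alpha) (alpha_lt1 : alpha < 1)
  (c_gt0 : 0 < c)
  (version : versionI omega c Omega \/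
     (versionII omega c (bisg_eta c alpha) Omega /\
      forall k xi, subdiff omega (y k) xi -> enorm xi <= D2))
  (steps : step_rule f g Lf x L Lbar)
  (iterates : bisg_iterates f g (bisg_eta c alpha) Omega L x y)
  (x'_opt : outer_sols f g omega x')
  (D1_gt0 : 0 < D1) (D2_gt0 : 0 < D2)
  (D1_bound : forall k, enorm (x k - x') <= D1)
  (D2_bound : forall k, enorm (Omega k (y k)) <= D2) :
  let D := D1 + D2 in
  let H := D ^+ 2 * Lbar / (1 - alpha) in
  forall k kbest : nat, (1 <= k)%N ->
    argmin [set j : nat | (k <= j <= 2 * k)%N] (fun j => (omega (y j))%:E)
      kbest ->
    (inner_obj f g (y kbest) - inner_obj f g x' <=
       (2 * H / k%:R `^ alpha)%:E)%E /\
    omega (y kbest) - omega x' <= 2 * D ^+ 2 / (c * k%:R `^ (1 - alpha)).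
Proof.
move=> D H k kb k1 [/andP[kkb kb2k] kbmin].
have [x'sol _] := x'_opt.
have pg : proper_fun g by case: g_convex.
have c1 : c <= 1.
  case: version => [[]//|[[sigma [psi [Ls [_ _ _ cL _]]]] _]].
  by move: cL; rewrite le_min => /andP[].
have k0 : 0 < k%:R :> R by rewrite ltr0n.
have al0 : 0 < alpha by lra.
have Np j : j.+1%:R `^ (- alpha) <= 1 :> R.
  by rewrite powRN invf_le1 ?powR_gt0// -[leLHS](powRr0 j.+1%:R) ler_powR ?ler1n// ltW.
have etaP j : 0 <= bisg_eta c alpha j <= j.+1%:R `^ (- alpha).
  rewrite /bisg_eta mulr_ge0 ?powR_ge0 ?(ltW c_gt0)//=.
  by rewrite -[leRHS]mul1r ler_wpM2r ?powR_ge0.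
have gx' : g x' \is a fin_num := inner_sols_fin_num pg x'sol.
have stP := step_rule_bounds f_smooth Lf_gt0 steps.
have am := inner_sols_affine_minorant f_smooth g_convex x'sol.
have dec j : g (y j) \is a fin_num /\
    f (y j) + fine (g (y j)) - (f x' + fine (g x')) <=
    L j / 2 * (enorm (x' - x j) ^+ 2 - enorm (x' - y j) ^+ 2).
  have [/andP[L0 _] bt] := stP j; have [yE _] := iterates j.
  by have := prox_grad_decrease f_smooth g_convex am L0 bt gx'; rewrite -yE.
have opt j : f x' + fine (g x') <= f (y j) + fine (g (y j)).
  have [gy _] := dec j; have [_ /(_ (y j) I)] := x'sol.
  by rewrite /inner_obj -(fineK gx') -(fineK gy) lee_fin.
split.
- have [gy _] := dec kb.
  rewrite /inner_obj -(fineK gx') -(fineK gy) -!EFinD lee_fin.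
  case: kb kkb {kb2k kbmin gy} => [|j] kj; first by have := leq_trans k1 kj.
  have al01 : 0 < alpha <= 1 by rewrite al0 ltW.
  have := inner_rate f_smooth Lf_gt0 g_convex steps iterates x'sol al01 etaP
    D1_gt0 D2_gt0 D1_bound D2_bound j.
  move=> /le_trans; apply; rewrite -/D.
  have Lb0 : 0 < Lbar by have [/andP[? ?] _] := stP 0%N; lra.
  have DL : 0 <= D ^+ 2 * Lbar by rewrite mulr_ge0 ?sqr_ge0 ?ltW.
  apply: (@le_trans _ _ (2 * H * j.+1%:R `^ (- alpha))).
    rewrite ler_wpM2r ?powR_ge0// /H.
    have : D ^+ 2 * Lbar * 2 <= D ^+ 2 * Lbar / (1 - alpha).
      by rewrite ler_wpM2l// -[leLHS]invrK lef_pV2 ?posrE ?invr_gt0; lra.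
    lra.
  apply: ler_wpM2l; first by rewrite /H mulr_ge0// divr_ge0//; lra.
  rewrite powRN lef_pV2 ?posrE ?powR_gt0//.
  by rewrite ge0_ler_powR ?nnegrE ?ler_nat ?(ltW al0).
- have yx j : enorm (y j - x') <= enorm (x j - x').
    have [_ dj] := dec j; have [/andP[L0 _] _] := stP j.
    rewrite -(@ler_pXn2r _ 2) ?nnegrE ?enorm_ge0//.
    rewrite -[y j - x']opprB -[x j - x']opprB !enormN -subr_ge0.
    rewrite -(@pmulr_rge0 _ (L j / 2)) ?divr_gt0//.
    by apply: le_trans dj; rewrite subr_ge0.
  have eta0 j : 0 < bisg_eta c alpha j <= c.
    rewrite /bisg_eta mulr_gt0 ?powR_gt0//=.
    by rewrite -[leRHS]mulr1 ler_wpM2l// ltW.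
  have step := bisg_outer_step omega_convex eta0 version iterates D2_bound yx.
  have cal : 0 < c * k%:R `^ (1 - alpha) by rewrite mulr_gt0 ?powR_gt0.
  rewrite ler_pdivlMr//.
  have := @weighted_average_bound _ (fun j => enorm (x j - x') ^+ 2)
    (fun j => omega (y j) - omega x') (bisg_eta c alpha)
    (omega (y kb) - omega x') (D1 ^+ 2) (D2 ^+ 2) (c * k%:R `^ (1 - alpha) / 2) k.
  have -> : 2 * (c * k%:R `^ (1 - alpha) / 2) = c * k%:R `^ (1 - alpha) by field.
  move=> bound; rewrite [leLHS]mulrC; apply: le_trans (bound _ _ _ step _ _ _) _.
  + by move=> j; case/andP: (etaP j).
  + move=> j; rewrite sqr_ge0/= ler_pXn2r ?nnegrE ?enorm_ge0//; exact: ltW.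
  + exact: sqr_ge0.
  + by move=> j jk; have := kbmin j jk; rewrite lee_fin lerD2r.
  + by apply: sum_eta_sqr; rewrite ?c_gt0.
  + rewrite divr_ge0 ?(ltW cal)//=; apply: sum_eta => //; exact/andP.
  + rewrite /D; have := mulr_gt0 D1_gt0 D2_gt0; have := sqr_ge0 D1; lra.
Qed.
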